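(* The finite Hilbert transform $T_2\colon L^2(-1,1)\to L^2(-1,1)$ has no continuous, $L^2$-valued extension to any genuinely larger Banach function space; that is, there is no Banach function space $Z$ with $L^2(-1,1)\subsetneq Z\subseteq L^1(-1,1)$ such that $T$ maps $Z$ continuously into $L^2(-1,1)$.
   Context: We work on $(-1,1)$ with Lebesgue measure. A Banach function space is a Banach space $Z$ of (classes of) complex measurable functions with the ideal property ($f\in Z$, $|g|\le|f|$ a.e. imply $g\in Z$, $\|g\|_Z\le\|f\|_Z$) and the Fatou property (if $f_n\in Z$, $0\le f_n\uparrow f$ a.e., $\sup_n\|f_n\|_Z<\infty$, then $f\in Z$ and $\|f_n\|_Z\to\|f\|_Z$). The finite Hilbert transform of $f\in L^1(-1,1)$ is $(Tf)(t)=\lim_{\varepsilon\to0^+}\frac1\pi\big(\int_{-1}^{t-\varepsilon}+\int_{t+\varepsilon}^1\big)\frac{f(x)}{x-t}\,dx$ (exists a.e.); it maps $L^2(-1,1)$ boundedly into itself, and this operator is denoted $T_2$. *)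

(* Defs.v *)
From HB Require Import structures.
From mathcomp Require Import all_boot all_order all_algebra.
From mathcomp Require Import all_classical all_reals all_analysis.
From mathcomp Require Import complex.
Set Implicit Arguments. Unset Strict Implicit. Unset Printing Implicit Defensive.
Import Order.TTheory GRing.Theory Num.Theory.
Import numFieldNormedType.Exports.
Local Open Scope classical_set_scope.
Local Open Scope ring_scope.

Section Defs.
Variable R : realType.
Local Notation C := (R[i]).
Local Notation mu := (@lebesgue_measure R).

Definition I11 : set R := `](-1), 1[.

Definition cre (z : C) : R := complex.Re z.
Definition cim (z : C) : R := complex.Im z.

Definition cabs (z : C) : R := Num.sqrt (cre z ^+ 2 + cim z ^+ 2).

Definition cmeasurable (f : R -> C) : Prop :=
  measurable_fun I11 (fun x => cre (f x)) /\ measurable_fun I11 (fun x => cim (f x)).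

Definition ae11 (P : R -> Prop) : Prop := {ae mu, forall x, I11 x -> P x}.

Definition inL1 (f : R -> C) : Prop :=
  cmeasurable f /\ (\int[mu]_(x in I11) (cabs (f x))%:E < +oo)%E.
Definition inL2 (f : R -> C) : Prop :=
  cmeasurable f /\ (\int[mu]_(x in I11) ((cabs (f x)) ^+ 2)%:E < +oo)%E.
Definition L2norm (f : R -> C) : R :=
  Num.sqrt (fine (\int[mu]_(x in I11) ((cabs (f x)) ^+ 2)%:E)).

Definition hilbert_trunc (g : R -> R) (t eps : R) : R :=
  pi^-1 * fine (\int[mu]_(x in I11 `\` `[t - eps, t + eps])
                  (g x / (x - t))%:E).

Definition hilbert_real (g : R -> R) (t : R) : R :=
  lim (hilbert_trunc g t eps @[eps --> 0^'+]).

Definition hilbertT (f : R -> C) (t : R) : C :=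
  ((hilbert_real (fun x => cre (f x)) t)%:C)%C
  + 'i%C * ((hilbert_real (fun x => cim (f x)) t)%:C)%C.

(* Banach function space on (-1,1): a set Zs of (measurable representatives of)
   functions with a norm nZ, forming a Banach space of classes, with the ideal
   and Fatou properties. *)
Definition banach_function_space (Zs : set (R -> C)) (nZ : (R -> C) -> R) : Prop :=
  (forall f, Zs f -> cmeasurable f) /\
  [/\
      [/\ Zs (fun _ => 0),
          (forall f g, Zs f -> Zs g -> Zs (fun x => f x + g x)) &
          (forall (c : C) f, Zs f -> Zs (fun x => c * f x))],
      [/\ (forall f, Zs f -> 0 <= nZ f),
          (forall f g, Zs f -> Zs g -> nZ (fun x => f x + g x) <= nZ f + nZ g),
          (forall (c : C) f, Zs f -> nZ (fun x => c * f x) = cabs c * nZ f) &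
          (forall f, Zs f -> nZ f = 0 -> ae11 (fun x => f x = 0))],
      (forall u : nat -> R -> C, (forall n, Zs (u n)) ->
         (forall e : R, 0 < e -> exists N : nat, forall m n : nat, (N <= m)%N -> (N <= n)%N ->
             nZ (fun x => u m x - u n x) < e) ->
         (exists f, Zs f /\ ((nZ (fun x => u n x - f x)) @[n --> \oo] --> (0 : R)))),
      (forall f g, Zs f -> cmeasurable g -> ae11 (fun x => cabs (g x) <= cabs (f x)) ->
         Zs g /\ nZ g <= nZ f) &
      (forall (fn : nat -> R -> C) (f : R -> C), (forall n, Zs (fn n)) -> cmeasurable f ->
         ae11 (fun x => (forall n, 0 <= fn n x <= fn n.+1 x) /\ cim (f x) = 0 /\
                        (cre (fn n x)) @[n --> \oo] --> cre (f x)) ->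
         (exists M : R, forall n, nZ (fn n) <= M) ->
         Zs f /\ (nZ (fn n)) @[n --> \oo] --> nZ f)].

End Defs.

(* Main.v *)
Require Import Defs.
From HB Require Import structures.
From mathcomp Require Import all_boot all_order all_algebra.
From mathcomp Require Import all_classical all_reals all_analysis.
From mathcomp Require Import complex.
From mathcomp Require Import measurable_realfun ring lra.
Import Order.TTheory GRing.Theory Num.Theory.
Import numFieldNormedType.Exports.
Local Open Scope classical_set_scope.
Local Open Scope ring_scope.
Set Implicit Arguments. Unset Strict Implicit. Unset Printing Implicit Defensive.

(** If [f >= 0] lies in [Z], then by the ideal property so does every
    measurable [u] with [|u| <= f], and [T u] is bounded in [L^2] uniformly in
    such [u].  Cut (-1,1) into cells of length [2 d] and let [u_k] be [f]
    restricted to the left half of the [k]-th cell.  Choosing signs and using the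
    parallelogram law, the sum of the [||T u_k||_2^2] over the right halves is
    bounded by the same constant as a single [||T (sum of +-u_k)||_2^2].  On the
    right half of its own cell [T u_k] is an ordinary integral of constant sign,
    of modulus at least [(2 pi)^-1] times the mean of [f] over the left half.
    Hence the step functions made of these means are bounded in [L^2] as [d -> 0]; they
    converge to [f] a.e. by Lebesgue differentiation, so [f] is in [L^2] by
    Fatou. *)

(** * The Cauchy transform away from the support of its density *)

Section offdiagonal_cauchy_transform.
Context {R : realType}.
Local Notation mu := (@lebesgue_measure R).
Implicit Types (f u v : R -> R) (t d : R).

(** Inversion is discontinuous at 0, so it is rewritten through the measurable power function; at 0
    both sides take the default value 0. *)
Lemma measurable_funV : measurable_fun [set: R] (fun x : R => x^-1).
Proof.
have -> : (fun x : R => x^-1) = (fun x => x * (x ^+ 2) `^ (-1)).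
  apply/funext => x; rewrite powR_inv1 ?sqr_ge0//.
  have [->|x0] := eqVneq x 0; first by rewrite invr0 mul0r.
  by rewrite expr2 invfM mulrA divff// mul1r.
apply: measurable_funM => //.
apply: (measurableT_comp (measurable_powR _)).
exact: measurable_funX.
Qed.

(** There is no principal value here: the formula is meant for [t] at positive distance from the
    support of [u], and the factor [pi^-1] is left out. *)
Definition cauchy_transform u t := \int[mu]_x (u x / (x - t)).

(** Tonelli is applied separately to the positive and negative parts of the kernel on the plane,
    which also covers the [t] where the integral diverges. *)
Lemma measurable_cauchy_transform u : measurable_fun [set: R] u ->
  measurable_fun [set: R] (cauchy_transform u).
Proof.
move=> um.
pose k (z : R * R) := (u z.1 / (z.1 - z.2))%:E.
have mk : measurable_fun [set: R * R] k.
  apply/measurable_EFinP; apply: measurable_funM.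
    exact: measurableT_comp.
  apply: (measurableT_comp measurable_funV).
  exact: measurable_funB.
have -> : cauchy_transform u = fine \o (fun t => (\int[mu]_x k (x, t))%E).
  by [].
apply: measurableT_comp => //.
have kE t : (\int[mu]_x k (x, t) =
    \int[mu]_x k^\+ (x, t) - \int[mu]_x k^\- (x, t))%E.
  rewrite integralE; congr (_ - _)%E; apply: eq_integral => x _.
    by rewrite !funeposE.
  by rewrite !funenegE.
under eq_fun do rewrite kE.
apply: emeasurable_funB.
- exact: (@measurable_fun_fubini_tonelli_G _ _ _ _ _ mu _ (measurable_funepos mk)).
- exact: (@measurable_fun_fubini_tonelli_G _ _ _ _ _ mu _ (measurable_funeneg mk)).
Qed.

(** Outside the interval where [u] vanishes the kernel is at most [d^-1], so [d^-1 * f]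
    dominates. *)
Lemma integrable_cauchy_kernel f u t d : 0 < d ->
  mu.-integrable [set: R] (EFin \o f) ->
  measurable_fun [set: R] u -> (forall x, `|u x| <= f x) ->
  (forall x, t - d <= x <= t + d -> u x = 0) ->
  mu.-integrable [set: R] (fun x => (u x / (x - t))%:E).
Proof.
move=> d0 intf um uf u0.
apply: (@le_integrable _ _ _ mu _ measurableT _ (EFin \o (fun x => d^-1 * f x))) => //.
- apply/measurable_EFinP; apply: measurable_funM => //.
  apply: (measurableT_comp measurable_funV).
  exact: measurable_funB.
- move=> x _ /=; rewrite lee_fin.
  have f0 : 0 <= f x by exact: le_trans (uf x).
  rewrite [leRHS]ger0_norm; last by rewrite mulr_ge0 ?invr_ge0 ?(ltW d0).
  have [xt|xt] := boolP (t - d <= x <= t + d).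
    by rewrite u0// mul0r normr0 mulr_ge0 ?invr_ge0 ?(ltW d0).
  have dx : d <= `|x - t|.
    by rewrite leNgt; apply: contra xt; rewrite ltr_distl => /andP[/ltW-> /ltW->].
  rewrite normrM normfV mulrC ler_pM ?invr_ge0//.
  by rewrite lef_pV2// posrE// (lt_le_trans d0).
- exact: (@integrableZl _ _ _ mu _ measurableT d^-1 (EFin \o f)).
Qed.

(** Truncating at [eps < d] removes only points where [u] is 0, so the truncations are eventually
    constant as [eps] tends to 0. *)
Lemma hilbert_real_off_support u t d : 0 < d ->
  (forall x, ~ I11 x -> u x = 0) ->
  (forall x, t - d <= x <= t + d -> u x = 0) ->
  hilbert_real u t = pi^-1 * cauchy_transform u t.
Proof.
move=> d0 uI u0; apply: cvg_lim => //.
apply: cvg_near_cst.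
exists d => //= e /=; rewrite sub0r normrN => ed e0.
rewrite /hilbert_trunc /cauchy_transform /Rintegral.
congr (_ * fine _); rewrite [LHS]integral_mkcond.
apply: eq_integral => x _; rewrite patchE; case: ifPn => //.
rewrite notin_setE => /not_andP[xI|/contrapT].
  by rewrite uI// mul0r.
rewrite /= in_itv/= => /andP[x1 x2].
rewrite gtr0_norm// in ed.
by rewrite u0 ?mul0r//; apply/andP; split; lra.
Qed.

End offdiagonal_cauchy_transform.

(** * Sign averaging on an open set where the densities vanish *)

Section sign_averaging.
Context {R : realType}.
Local Notation mu := (@lebesgue_measure R).
Implicit Types (f g h u : R -> R) (O : set R) (M : R).

(* A bound on the finite Hilbert transform of every minorant of [f], stated
   through a measurable representative because [hilbert_real u] is a [lim] that
   may be a junk value on a null set. *)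
Definition hilbert_minorants_le f M := forall u, measurable_fun [set: R] u ->
  (forall x, `|u x| <= f x) ->
  exists g, [/\ measurable_fun (@I11 R) g,
    ae11 (fun t => hilbert_real u t = g t) &
    (\int[mu]_(t in @I11 R) (g t ^+ 2)%:E <= M%:E)%E].

Lemma open_cc_subset O t : open O -> O t ->
  exists2 d : R, 0 < d & forall x, t - d <= x <= t + d -> O x.
Proof.
move=> oO /oO /nbhs_ballP[e /= e0 teO]; exists (e / 2); first by rewrite divr_gt0.
move=> x /andP[x1 x2]; apply: teO.
by rewrite /ball/= ltr_distlC; apply/andP; split; lra.
Qed.

Variables (f : R -> R) (O : set R) (M : R).
Hypothesis intf : mu.-integrable [set: R] (EFin \o f).
Hypothesis fI : forall x, ~ I11 x -> f x = 0.
Hypothesis oO : open O.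
Hypothesis OI : O `<=` @I11 R.
Hypothesis fM : hilbert_minorants_le f M.

Let mO : measurable O. Proof. exact: open_measurable. Qed.

Let msq u : measurable_fun [set: R] u ->
  measurable_fun O (fun t => (cauchy_transform u t ^+ 2)%:E).
Proof.
move=> um; apply/measurable_EFinP; apply: measurable_funX.
exact: measurable_funTS (measurable_cauchy_transform um).
Qed.

(** On [O] the Hilbert transform of [u] is [pi^-1] times its Cauchy transform, whence the factor
    [pi ^+ 2]. *)
Lemma integral_cauchy_transform_sqr_le u : measurable_fun [set: R] u ->
  (forall x, `|u x| <= f x) -> (forall x, O x -> u x = 0) ->
  (\int[mu]_(t in O) (cauchy_transform u t ^+ 2)%:E <= (pi ^+ 2 * M)%:E)%E.
Proof.
move=> um uf uO.
have [g [mg Hg gM]] := fM um uf.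
have mI : measurable (@I11 R) by exact: measurable_itv.
have mg2 : measurable_fun (@I11 R) (fun t => (g t ^+ 2)%:E).
  by apply/measurable_EFinP; exact: measurable_funX.
apply: (@le_trans _ _ (\int[mu]_(t in O) ((pi ^+ 2)%:E * (g t ^+ 2)%:E))%E).
  apply: ae_ge0_le_integral => //.
  - by move=> t _; rewrite lee_fin sqr_ge0.
  - exact: msq.
  - by move=> t _; rewrite -EFinM lee_fin mulr_ge0 ?sqr_ge0.
  - apply: measurable_funeM; exact: measurable_funS mg2.
  - move: Hg; rewrite /ae11.
    apply: filterS; first exact: (ae_filter_ringOfSetsType mu).
    move=> t Hgt Ot.
    have [d d0 dO] := open_cc_subset oO Ot.
    rewrite -EFinM lee_fin -exprMn -Hgt; last exact: OI.
    rewrite (hilbert_real_off_support d0); last 2 first.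
    + by move=> x /fI fx; apply/eqP; rewrite -normr_le0 -fx.
    + by move=> x /dO /uO.
    by rewrite mulrA mulfV ?mul1r// gt_eqF// pi_gt0.
rewrite ge0_integralZl_EFin ?sqr_ge0//; last 2 first.
- by move=> t _; rewrite lee_fin sqr_ge0.
- exact: measurable_funS mg2.
rewrite (EFinM _ M) lee_pmul2l// ?lte_fin ?exprn_gt0 ?pi_gt0//.
apply: le_trans gM; apply: ge0_subset_integral => //.
by move=> t _; rewrite lee_fin sqr_ge0.
Qed.

(* Averaging over the two choices [h + u], [h - u] and the parallelogram law
   give, by induction, the orthogonality of random signs. *)
Lemma sum_integral_cauchy_transform_sqr_le (us : seq (R -> R)) h :
  measurable_fun [set: R] h ->
  {in us, forall u, measurable_fun [set: R] u} ->
  (forall x, `|h x| + \sum_(u <- us) `|u x| <= f x) ->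
  (forall x, O x -> h x = 0) ->
  {in us, forall u, forall x, O x -> u x = 0} ->
  (\int[mu]_(t in O) (cauchy_transform h t ^+ 2)%:E +
   \sum_(u <- us) \int[mu]_(t in O) (cauchy_transform u t ^+ 2)%:E
     <= (pi ^+ 2 * M)%:E)%E.
Proof.
elim: us h => [|u us IH] h mh mus hf hO usO.
  rewrite big_nil adde0; apply: integral_cauchy_transform_sqr_le => // x.
  by have := hf x; rewrite big_nil addr0.
have um : measurable_fun [set: R] u by apply: mus; rewrite mem_head.
have uO x : O x -> u x = 0 by apply: usO; rewrite mem_head.
have mus' : {in us, forall u, measurable_fun [set: R] u}.
  by move=> v vus; apply: mus; rewrite inE vus orbT.
have usO' : {in us, forall u, forall x, O x -> u x = 0}.
  by move=> v vus; apply: usO; rewrite inE vus orbT.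
have s0 x : 0 <= \sum_(v <- us) `|v x| by apply: sumr_ge0.
have huf x : `|h x| + `|u x| <= f x.
  by have := hf x; rewrite big_cons; have := s0 x; lra.
have mD : measurable_fun [set: R] (h \+ u) by exact: measurable_funD.
have mB : measurable_fun [set: R] (h \- u) by exact: measurable_funB.
(* By the triangle inequality [h + u] and [h - u] stay within the budget [f], so the induction
   hypothesis applies to both. *)
have HD : (\int[mu]_(t in O) (cauchy_transform (h \+ u) t ^+ 2)%:E +
   \sum_(v <- us) \int[mu]_(t in O) (cauchy_transform v t ^+ 2)%:E
     <= (pi ^+ 2 * M)%:E)%E.
  apply: IH => // [x|x Ox] /=; last by rewrite hO// uO// addr0.
  have := hf x; rewrite big_cons addrA; apply: le_trans.
  by rewrite lerD2r ler_normD.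
have HB : (\int[mu]_(t in O) (cauchy_transform (h \- u) t ^+ 2)%:E +
   \sum_(v <- us) \int[mu]_(t in O) (cauchy_transform v t ^+ 2)%:E
     <= (pi ^+ 2 * M)%:E)%E.
  apply: IH => // [x|x Ox] /=; last by rewrite hO// uO// subr0.
  have := hf x; rewrite big_cons addrA; apply: le_trans.
  by rewrite lerD2r ler_normB.
(* Only on [O] are both kernels integrable, which makes the transform additive there. *)
have parallelogram t : O t ->
    cauchy_transform (h \+ u) t ^+ 2 + cauchy_transform (h \- u) t ^+ 2 =
    (cauchy_transform h t ^+ 2 + cauchy_transform u t ^+ 2) +
    (cauchy_transform h t ^+ 2 + cauchy_transform u t ^+ 2).
  move=> Ot; have [d d0 dO] := open_cc_subset oO Ot.
  have ih : mu.-integrable [set: R] (fun x => (h x / (x - t))%:E).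
    apply: (integrable_cauchy_kernel d0 intf mh) => x; last by move/dO/hO.
    by have := huf x; have := normr_ge0 (u x); lra.
  have iu : mu.-integrable [set: R] (fun x => (u x / (x - t))%:E).
    apply: (integrable_cauchy_kernel d0 intf um) => x; last by move/dO/uO.
    by have := huf x; have := normr_ge0 (h x); lra.
  have -> : cauchy_transform (h \+ u) t = cauchy_transform h t + cauchy_transform u t.
    rewrite /cauchy_transform -RintegralD//.
    by congr fine; apply: eq_integral => x _; rewrite mulrDl.
  have -> : cauchy_transform (h \- u) t = cauchy_transform h t - cauchy_transform u t.
    rewrite /cauchy_transform -RintegralB//.
    by congr fine; apply: eq_integral => x _; rewrite mulrBl.
  by ring.
have sq0 v t : O t -> (0 <= (cauchy_transform v t ^+ 2)%:E)%E.
  by move=> _; rewrite lee_fin sqr_ge0.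
have AB : (\int[mu]_(t in O) (cauchy_transform (h \+ u) t ^+ 2)%:E +
    \int[mu]_(t in O) (cauchy_transform (h \- u) t ^+ 2)%:E =
    (\int[mu]_(t in O) (cauchy_transform h t ^+ 2)%:E +
     \int[mu]_(t in O) (cauchy_transform u t ^+ 2)%:E) +
    (\int[mu]_(t in O) (cauchy_transform h t ^+ 2)%:E +
     \int[mu]_(t in O) (cauchy_transform u t ^+ 2)%:E))%E.
  have mhu : measurable_fun O
      (fun t => (cauchy_transform h t ^+ 2)%:E + (cauchy_transform u t ^+ 2)%:E)%E.
    by apply: emeasurable_funD; exact: msq.
  rewrite -!ge0_integralD//; try exact: msq; try exact: sq0.
  - by apply: eq_integral => t /set_mem/parallelogram E; rewrite -!EFinD E.
  - by move=> t Ot; rewrite adde_ge0 ?sq0.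
  - by move=> t Ot; rewrite adde_ge0 ?sq0.
rewrite big_cons addeA.
(* The sum of the two bounds is twice the goal; halving it is done by cases on the extended real
   [X + C]. *)
have := leeD HD HB; rewrite addeACA AB.
set X := (\int[mu]_(t in O) (cauchy_transform h t ^+ 2)%:E + _)%E; set C := (\sum_(v <- us) _)%E.
rewrite addeACA; case: (X + C)%E => [r||]//; last by move=> _; rewrite leNye.
by rewrite -!EFinD !lee_fin; lra.
Qed.
End sign_averaging.

(** Meant for functions with disjoint supports, evaluated at a point; [0 <= a] covers the case
    [n <= j]. *)
Lemma sum_nat_le_single {R : realType} (F : nat -> R) (a : R) (j n : nat) :
  0 <= a -> (forall k, F k <= if k == j then a else 0) ->
  \sum_(0 <= k < n) F k <= a.
Proof.
move=> a0 Fa; apply: (@le_trans _ _ (\sum_(0 <= k < n | k == j) a)).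
  by rewrite [leRHS]big_mkcond; exact: ler_sum.
by rewrite big_nat1_eq; case: ifP.
Qed.

(** * Cells, their left halves, and the associated step functions *)

Section cells.
Context {R : realType}.
Local Notation mu := (@lebesgue_measure R).
Implicit Types (f : R -> R) (x t p d : R).

(** For [x] in the left half and [t] in the right half, [0 < t - x <= 2 * d], so the kernel is at
    most [- (2 * d)^-1] and nothing cancels. *)
Lemma cauchy_transform_half_cell_ge f p d t : 0 < d ->
  mu.-integrable [set: R] (EFin \o f) -> measurable_fun [set: R] f ->
  (forall x, 0 <= f x) -> p + d < t < p + 2 * d ->
  ((\int[mu]_(x in `[p, p + d[) f x) / (2 * d)) ^+ 2 <=
  cauchy_transform (f \_ `[p, p + d[) t ^+ 2.
Proof.
move=> d0 intf mf f0 /andP[t1 t2].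
set L := [set` `[p, p + d[]; set u := f \_ L.
have mL : measurable L by exact: measurable_itv.
have um : measurable_fun [set: R] u.
  by apply/(measurable_restrictT f mL); exact: measurable_funTS.
have uf x : `|u x| <= f x.
  by rewrite /u patchE; case: ifP => _; rewrite ?normr0// ger0_norm.
have intu : mu.-integrable [set: R] (EFin \o u).
  apply: (@le_integrable _ _ _ mu _ measurableT _ (EFin \o f)) => //.
    exact/measurable_EFinP.
  by move=> x _; rewrite lee_fin (le_trans (uf x))// ler_norm.
set c := Rintegral _ _ _.
have cE : c = \int[mu]_x u x by rewrite /c Rintegral_mkcond.
have c0 : 0 <= c by exact: Rintegral_ge0.
(* Both sides of this upper bound are nonpositive, so squaring reverses it. *)
suff Cc : cauchy_transform u t <= (- (2 * d)^-1) * c.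
  rewrite -[leRHS]sqrrN ler_sqr ?nnegrE ?divr_ge0//; last 2 first.
  - by lra.
  - rewrite oppr_ge0 (le_trans Cc)// mulNr oppr_le0 mulr_ge0// invr_ge0; lra.
  by rewrite lerNr mulrC -mulNr.
rewrite cE -RintegralZl//; apply: le_Rintegral => //.
(* The radius [t - (p + d)] is the distance from [t] to the half cell, whose right endpoint is
   excluded. *)
- apply: (@integrable_cauchy_kernel _ f u t (t - (p + d))) => //; first by lra.
  move=> x /andP[x1 x2]; rewrite /u patchE; case: ifPn => //.
  by rewrite inE /L /= in_itv/= => /andP[? ?]; lra.
- exact: (@integrableZl _ _ _ mu _ measurableT _ (EFin \o u)).
- move=> x _; rewrite mulrC /u patchE; case: ifPn; last by rewrite !mulr0.
  rewrite inE /L /= in_itv/= => /andP[x1 x2].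
  apply: ler_wpM2r => //; rewrite -(opprB t x) invrN lerN2.
  by rewrite lef_pV2 ?posrE; lra.
Qed.

(** Half the length of a cell: [m.+1] cells of length [2 * mesh m] tile [[-1, 1)]. *)
Definition mesh (m : nat) : R := m.+1%:R^-1.
Definition knot (m k : nat) : R := - 1 + 2 * mesh m * k%:R.
Definition half_cell (m k : nat) : set R := `[knot m k, knot m k + mesh m[.
Definition cell (m k : nat) : set R := `[knot m k, knot m k + 2 * mesh m[.
Definition cell_index (m : nat) (x : R) : nat := Num.trunc ((x + 1) / (2 * mesh m)).

Lemma mesh_gt0 m : 0 < mesh m. Proof. by rewrite invr_gt0. Qed.

Lemma cellP m k x : cell m k x -> k = cell_index m x.
Proof.
rewrite /cell /= in_itv/= /knot => /andP[x1 x2]; apply/esym/truncn_def.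
have d0 := mesh_gt0 m.
rewrite ler_pdivlMr ?ltr_pdivrMr ?mulr_gt0//; apply/andP; split; first by lra.
by rewrite -natr1; lra.
Qed.

Lemma cell_indexP m x : I11 x -> cell m (cell_index m x) x.
Proof.
rewrite /I11 /cell /knot /= !in_itv/= => /andP[x1 x2].
have d0 := mesh_gt0 m.
have /truncn_itv : 0 <= (x + 1) / (2 * mesh m) by rewrite divr_ge0//; lra.
rewrite -/(cell_index m x) ler_pdivlMr ?ltr_pdivrMr ?mulr_gt0//.
by rewrite -natr1 => /andP[? ?]; apply/andP; split; lra.
Qed.

Lemma cell_index_lt m x : I11 x -> (cell_index m x < m.+1)%N.
Proof.
rewrite /I11 /= in_itv/= => /andP[x1 x2].
rewrite -(ltr_nat R); apply: le_lt_trans (_ : (x + 1) / (2 * mesh m) < _).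
  rewrite truncn_le divr_ge0 ?mulr_ge0// ?invr_ge0//; lra.
rewrite ltr_pdivrMr ?mulr_gt0 ?mesh_gt0// /mesh mulrCA divff//; lra.
Qed.

Lemma half_cell_cell m k : half_cell m k `<=` cell m k.
Proof.
move=> x; rewrite /half_cell /cell /= !in_itv/= => /andP[-> /=].
by have := mesh_gt0 m; lra.
Qed.

Definition half_cell_mean f m k := (\int[mu]_(x in half_cell m k) f x) / mesh m.

(** The mean over the left half is spread over the whole cell, so that these functions can
    approximate [f] on all of (-1,1). *)
Definition cell_step f m x :=
  \sum_(0 <= k < m.+1) half_cell_mean f m k * \1_(cell m k) x.

(** Exactly one indicator is nonzero at [x]. Stated for any [F], it serves both the means and their
    squares. *)
Lemma sum_cellE m (F : nat -> R) x : I11 x ->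
  \sum_(0 <= k < m.+1) F k * \1_(cell m k) x = F (cell_index m x).
Proof.
move=> Ix.
transitivity (\sum_(0 <= k < m.+1 | k == cell_index m x) F k).
  rewrite [RHS]big_mkcond/=; apply: eq_bigr => k _; rewrite indicE.
  case: eqP => [->|kx]; first by rewrite mem_set ?mulr1//; exact: cell_indexP.
  by rewrite memNset ?mulr0// => /cellP.
by rewrite big_nat1_eq /= cell_index_lt.
Qed.

Lemma measurable_cell_step f m : measurable_fun [set: R] (cell_step f m).
Proof.
apply: measurable_sum => k; apply: measurable_funM => //.
apply: measurable_indic; exact: measurable_itv.
Qed.

End cells.

(** * A bound for the step functions in $L^2$, uniform in the mesh *)

Section square_integrability.
Context {R : realType}.
Local Notation mu := (@lebesgue_measure R).
Variables (f : R -> R) (M : R).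
Hypothesis mf : measurable_fun [set: R] f.
Hypothesis f0 : forall x, 0 <= f x.
Hypothesis intf : mu.-integrable [set: R] (EFin \o f).
Hypothesis fI : forall x, ~ I11 x -> f x = 0.
Hypothesis fM : hilbert_minorants_le f M.

(** Sign averaging applies to the restrictions of [f] to the left halves, with [O] the union of the
    right halves. The constant 8 is 4, from the kernel bound, times 2, from passing from a half cell
    to a cell. *)
Lemma sum_half_cell_mean_sqr_le m :
  \sum_(0 <= k < m.+1) half_cell_mean f m k ^+ 2 * (2 * mesh m) <=
  8 * (pi ^+ 2 * M).
Proof.
have d0 := @mesh_gt0 R m.
(* The right halves are taken open, so that [O] is open and misses every left half. *)
pose B k : set R := `]knot m k + mesh m, knot m k + 2 * mesh m[%classic.
have mB k : measurable (B k) by exact: measurable_itv.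
have B_cell k : B k `<=` cell m k.
  by move=> x; rewrite /B /cell /= !in_itv/= => /andP[? ->]; rewrite andbT; lra.
have BN k j x : B k x -> half_cell m j x -> False.
  move=> Bx Hx; have jk : j = k.
    by rewrite (cellP (half_cell_cell Hx)) -(cellP (B_cell _ _ Bx)).
  move: Bx Hx; rewrite /B /half_cell jk /= !in_itv/= => /andP[? ?] /andP[? ?]; lra.
pose O : set R := \bigcup_(k in `I_m.+1) B k.
have oO : open O by apply: bigcup_open => k _; exact: itv_open.
have OI : O `<=` @I11 R.
  move=> x [k /= km]; rewrite /B /I11 /knot /= !in_itv/= => /andP[x1 x2].
  have k0 : 0 <= mesh m * k%:R :> R by rewrite mulr_ge0// ltW.
  have k1 : mesh m * k.+1%:R <= 1 :> R.
    by rewrite /mesh mulrC ler_pdivrMr// mul1r ler_nat.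
  rewrite -natr1 in k1.
  by apply/andP; split; lra.
pose u k := f \_ (half_cell m k).
have um k : measurable_fun [set: R] (u k).
  have mL : measurable (half_cell m k : set R) by exact: measurable_itv.
  by apply/(measurable_restrictT f mL); exact: measurable_funTS.
have uO k x : O x -> u k x = 0.
  move=> [j _ Bj]; rewrite /u patchE; case: ifPn => //.
  by rewrite inE => /(BN _ _ _ Bj).
have := @sum_integral_cauchy_transform_sqr_le _ f O M intf fI oO OI fM
  [seq u k | k <- index_iota 0 m.+1] (cst 0) (@measurable_cst _ _ _ _ _ _).
rewrite big_map => H.
have {}H : (\sum_(0 <= k < m.+1) \int[mu]_(t in O) (cauchy_transform (u k) t ^+ 2)%:E
   <= (pi ^+ 2 * M)%:E)%E.
  apply: le_trans (H _ _ _ _) => //.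
  - by rewrite leeDr// integral_ge0// => t _; rewrite lee_fin sqr_ge0.
  - by move=> _ /mapP[k _ ->].
  - move=> x; rewrite normr0 add0r big_map.
    (* The left halves are disjoint: only the one in the cell of [x] can contribute. *)
    apply: (@sum_nat_le_single _ _ _ (cell_index m x)) => // k.
    rewrite /u patchE; case: ifPn; last by rewrite normr0; case: ifP.
    by rewrite inE => /half_cell_cell/cellP ->; rewrite eqxx ger0_norm.
  - by move=> _ /mapP[k _ ->] x; exact: uO.
have {H} : (\sum_(0 <= k < m.+1) ((half_cell_mean f m k / 2) ^+ 2 * mesh m)%:E
   <= (pi ^+ 2 * M)%:E)%E.
  apply: le_trans H; rewrite [leLHS]big_nat [leRHS]big_nat; apply: lee_sum => k /= km.
  have msq : measurable_fun [set: R] (fun t => (cauchy_transform (u k) t ^+ 2)%:E).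
    apply/measurable_EFinP; apply: measurable_funX.
    exact: measurable_cauchy_transform.
  apply: (@le_trans _ _ (\int[mu]_(t in B k) (cauchy_transform (u k) t ^+ 2)%:E)%E).
    have muB : mu (B k) = (mesh m)%:E.
      rewrite lebesgue_measure_itv/= lte_fin ifT; last by lra.
      by rewrite -EFinD; congr (_%:E); lra.
    rewrite EFinM -muB -(integral_cst mu (mB k)).
    apply: ge0_le_integral => //.
    - exact: mB.
    - by move=> t _ /=; rewrite lee_fin sqr_ge0.
    - exact: measurable_funTS msq.
    - move=> t; rewrite /B /= in_itv/= => tB; rewrite /= lee_fin.
      apply: le_trans (cauchy_transform_half_cell_ge d0 intf mf f0 tB).
      by rewrite /half_cell_mean invfM mulrA mulrAC.
  apply: ge0_subset_integral => //.
  - exact: mB.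
  - exact: open_measurable.
  - exact: measurable_funTS msq.
  - by move=> t _; rewrite lee_fin sqr_ge0.
  - by move=> t Bt; exists k.
rewrite sumEFin lee_fin => H.
have -> : \sum_(0 <= k < m.+1) half_cell_mean f m k ^+ 2 * (2 * mesh m) =
    8 * \sum_(0 <= k < m.+1) (half_cell_mean f m k / 2) ^+ 2 * mesh m.
  by rewrite mulr_sumr; apply: eq_bigr => k _; field.
by rewrite ler_pM2l.
Qed.

(** Since the cells are disjoint, the square of the step function is the step function of the
    squares. *)
Lemma integral_cell_step_sqr_le m :
  (\int[mu]_(x in @I11 R) (cell_step f m x ^+ 2)%:E <= (8 * (pi ^+ 2 * M))%:E)%E.
Proof.
have mI : measurable (@I11 R) by exact: measurable_itv.
have mC k : measurable (cell m k : set R) by exact: measurable_itv.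
have sqE x : I11 x -> (cell_step f m x ^+ 2)%:E =
    (\sum_(0 <= k < m.+1) (half_cell_mean f m k ^+ 2)%:E * (\1_(cell m k) x)%:E)%E.
  move=> Ix; rewrite /cell_step (sum_cellE m (half_cell_mean f m))//.
  by rewrite -(sum_cellE m (fun k => half_cell_mean f m k ^+ 2))// -sumEFin.
under eq_integral => x /set_mem Ix do rewrite (sqE _ Ix).
rewrite ge0_integral_sum//; last 2 first.
- move=> k; apply: measurable_funeM; apply/measurable_EFinP.
  apply: measurable_indic; exact: mC.
- by move=> k x _; rewrite -EFinM lee_fin mulr_ge0// sqr_ge0.
have := sum_half_cell_mean_sqr_le m; rewrite -lee_fin -sumEFin; apply: le_trans.
apply: lee_sum => k _.
rewrite ge0_integralZl_EFin ?sqr_ge0//; last first.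
  by apply/measurable_EFinP; apply: measurable_indic; exact: mC.
rewrite (EFinM _ (2 * mesh m)) lee_wpmul2l ?lee_fin ?sqr_ge0//.
rewrite integral_indic//; last exact: mC.
(* The first cell contains -1, which is not in [I11], so intersecting with [I11] is handled by
   monotonicity of the measure. *)
apply: (@le_trans _ _ (mu (cell m k))).
  by apply: le_measure; rewrite ?inE//; [exact: (measurableI _ _ (mC k) mI)|exact: mC].
rewrite /cell lebesgue_measure_itv/= lte_fin ifT; last by have := @mesh_gt0 R m; lra.
by rewrite -EFinD lee_fin; lra.
Qed.

End square_integrability.

(** * Lebesgue differentiation and passage to the limit *)

Section differentiation.
Context {R : realType}.
Local Notation mu := (@lebesgue_measure R).

(** The left half of the cell of [x] need not contain [x], but it shrinks nicely to [x], which
    suffices for Lebesgue differentiation. *)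
Lemma cell_step_cvg (f : R -> R) : mu.-integrable [set: R] (EFin \o f) ->
  ae11 (fun x => cell_step f m x @[m --> \oo] --> f x).
Proof.
move=> intf.
(* Nice shrinking is proved for every real [x], so the integer floor is used; on [I11] it agrees
   with [cell_index]. *)
pose q (x : R) (m : nat) : R :=
  - 1 + 2 * mesh m * (Num.floor ((x + 1) / (2 * mesh m)))%:~R.
pose E x m : set R := `[q x m, q x m + mesh m[%classic.
have mE x m : measurable (E x m) by exact: measurable_itv.
have muE x m : mu (E x m) = (mesh m)%:E.
  rewrite lebesgue_measure_itv/= lte_fin ltrDl mesh_gt0.
  by rewrite -EFinD; congr (_%:E); lra.
have d0 m := @mesh_gt0 R m.
have r0 m : 0 < 2 * mesh m :> R by rewrite mulr_gt0.
have qP x m : q x m <= x < q x m + 2 * mesh m.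
  have := floor_itv ((x + 1) / (2 * mesh m)).
  rewrite ler_pdivlMr ?ltr_pdivrMr// intrD /q => /andP[h1 h2].
  by apply/andP; split; lra.
have nE x : nicely_shrinking x (E x).
  split; first exact: mE.
  (* The ball of radius [2 * mesh m] has length [4 * mesh m], four times that of the half cell. *)
  exists (4, fun m => PosNum (r0 m)); split => //=.
  - rewrite -[X in _ --> X](mulr0 2); apply: cvgM; first exact: cvg_cst.
    exact: cvg_harmonic.
  - move=> m y; rewrite /E /= in_itv/= /ball/= ltr_distlC => /andP[y1 y2].
    by have /andP[? ?] := qP x m; have := d0 m => ?; apply/andP; split; lra.
  - move=> m; rewrite lebesgue_measure_ball ?(ltW (r0 m))//.
    by rewrite -/(E x m) muE -EFinM lee_fin mulr2n; lra.
have locf : locally_integrable [set: R] f.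
  exact: open_integrable_locally openT intf.
have := lebesgue_differentiation locf; rewrite /ae11.
apply: filterS; first exact: (ae_filter_ringOfSetsType mu).
move=> x fx Ix.
have := nice_lebesgue_differentiation nE locf fx.
have stepE m : (cell_step f m x)%:E = ((mu (E x m))^-1 * \int[mu]_(y in E x m) (f y)%:E)%E.
  rewrite muE /cell_step (sum_cellE m (half_cell_mean f m))//.
  have qE : q x m = knot m (cell_index m x).
    have y0 : 0 <= (x + 1) / (2 * mesh m).
      by move: Ix; rewrite /I11 /= in_itv/= => /andP[? _]; rewrite divr_ge0 ?(ltW (r0 m))//; lra.
    rewrite /q /knot /cell_index truncn_floor y0 natr_absz ger0_norm//.
    by rewrite floor_ge0.
  have intE : mu.-integrable (E x m) (EFin \o f).
    by apply: integrableS intf => //; exact: mE.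
  have finE : (\int[mu]_(y in E x m) (f y)%:E)%E \is a fin_num.
    by apply: integrable_fin_num intE; exact: mE.
  rewrite inver gt_eqF// -(fineK finE) -EFinM mulrC.
  by rewrite /half_cell_mean /Rintegral /half_cell -qE.
under eq_fun do rewrite -stepE.
by move/fine_cvgP => [_].
Qed.

Lemma integral_sqr_le_of_hilbert_minorants (f : R -> R) (M : R) :
  measurable_fun [set: R] f -> (forall x, 0 <= f x) ->
  mu.-integrable [set: R] (EFin \o f) -> (forall x, ~ I11 x -> f x = 0) ->
  hilbert_minorants_le f M ->
  (\int[mu]_(x in @I11 R) (f x ^+ 2)%:E <= (8 * (pi ^+ 2 * M))%:E)%E.
Proof.
move=> mf f0 intf fI fM.
have mI : measurable (@I11 R) by exact: measurable_itv.
(* Removing the null set [N] makes the convergence hold at every remaining point, so the integrand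
   can be rewritten as a lower limit for Fatou. *)
have [N [mN N0 HN]] := cell_step_cvg intf.
have mIN : measurable (@I11 R `\` N) by exact: measurableD.
rewrite (ge0_negligible_integral _ _ _ _ N0)//; last 2 first.
- by apply/measurable_EFinP; apply: measurable_funX; exact: measurable_funTS mf.
- by move=> x _; rewrite lee_fin sqr_ge0.
pose F m x := (cell_step f m x ^+ 2)%:E.
have mF m D : measurable_fun D (F m).
  apply: measurable_funTS; apply/measurable_EFinP; apply: measurable_funX.
  exact: measurable_cell_step.
have F0 m x : (0 <= F m x)%E by rewrite lee_fin sqr_ge0.
have limF x : (@I11 R `\` N) x -> (f x ^+ 2)%:E = limn_einf (F ^~ x).
  move=> [Ix Nx]; have : cell_step f m x @[m --> \oo] --> f x.
    by apply: contrapT => H; apply: Nx; apply: HN => /= /(_ Ix).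
  move=> fx; have : F m x @[m --> \oo] --> (f x ^+ 2)%:E.
    apply: cvg_EFin; first exact: nearW.
    rewrite /comp /F/=.
    under eq_fun do rewrite expr2.
    by rewrite expr2; apply: cvgM.
  by move/cvg_limn_einf_sup => [->].
under eq_integral => x /set_mem Dx do rewrite (limF _ Dx).
apply: (le_trans (@fatou _ _ _ mu _ mIN F (fun m => mF m _) (fun m x _ => F0 m x))).
(* Each tail infimum is at most its first term, which has the uniform bound. *)
rewrite limn_einf_lim; apply: lime_le; first exact: is_cvg_einfs.
apply: nearW => m; apply: le_trans (ereal_inf_lbound _) _; first by exists m => /=.
apply: le_trans (integral_cell_step_sqr_le mf f0 intf fI fM m).
apply: ge0_subset_integral => //; exact: mF.
Qed.

End differentiation.

(** * Almost everywhere statements and moduli of complex functions *)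

Lemma ae11S {R : realType} (P Q : R -> Prop) :
  (forall x, I11 x -> P x -> Q x) -> ae11 P -> ae11 Q.
Proof.
move=> PQ; rewrite /ae11.
apply: filterS; first exact: (ae_filter_ringOfSetsType lebesgue_measure).
by move=> x Px Ix; exact: PQ (Px Ix).
Qed.

Section modulus.
Context {R : realType}.
Local Notation mu := (@lebesgue_measure R).
Implicit Types (f g : R -> R[i]) (z : R[i]).

Lemma cabs_ge0 z : 0 <= cabs z.
Proof. exact: sqrtr_ge0. Qed.

Lemma sqr_cabs z : cabs z ^+ 2 = cre z ^+ 2 + cim z ^+ 2.
Proof. by rewrite sqr_sqrtr// addr_ge0 ?sqr_ge0. Qed.

Lemma cabs_real (r : R) : cabs (r%:C)%C = `|r|.
Proof. by rewrite /cabs /cre /cim /= expr0n addr0 sqrtr_sqr. Qed.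

Lemma cre_hilbertT_real (u : R -> R) t :
  cre (hilbertT (fun x => (u x)%:C%C) t) = hilbert_real u t.
Proof. by rewrite /hilbertT /cre /= mul0r mul1r subrr addr0. Qed.

Lemma measurable_cabs f : cmeasurable f ->
  measurable_fun (@I11 R) (fun x => cabs (f x)).
Proof.
move=> [mre mim].
have -> : (fun x => cabs (f x)) =
    (fun x => (cre (f x) ^+ 2 + cim (f x) ^+ 2) `^ 2^-1).
  by apply/funext => x; rewrite powR12_sqrt// addr_ge0 ?sqr_ge0.
apply: (measurableT_comp (measurable_powR _)).
by apply: measurable_funD; exact: measurable_funX.
Qed.

Lemma integral_cre_sqr_le f (K : R) : inL2 f -> L2norm f <= K ->
  (\int[mu]_(x in @I11 R) (cre (f x) ^+ 2)%:E <= (K ^+ 2)%:E)%E.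
Proof.
move=> [[mre mim] ffin] fK.
have mI : measurable (@I11 R) by exact: measurable_itv.
have m2 : measurable_fun (@I11 R) (fun x => cabs (f x) ^+ 2).
  under eq_fun do rewrite sqr_cabs.
  by apply: measurable_funD; exact: measurable_funX.
have I0 : (0 <= \int[mu]_(x in @I11 R) (cabs (f x) ^+ 2)%:E)%E.
  by apply: integral_ge0 => x _; rewrite lee_fin sqr_ge0.
apply: (@le_trans _ _ (\int[mu]_(x in @I11 R) (cabs (f x) ^+ 2)%:E)%E).
  apply: ge0_le_integral => //.
  - by move=> x _; rewrite lee_fin sqr_ge0.
  - by apply/measurable_EFinP; exact: measurable_funX.
  - exact/measurable_EFinP.
  - by move=> x _; rewrite lee_fin sqr_cabs lerDl sqr_ge0.
(* Finiteness matters: [L2norm] is defined through [fine], which sends an infinite integral to 0. *)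
rewrite -(@fineK _ (integral _ _ _)) ?ge0_fin_numE// lee_fin.
rewrite -[leLHS]sqr_sqrtr ?fine_ge0// ler_sqr ?nnegrE ?sqrtr_ge0//.
exact: le_trans (sqrtr_ge0 _) fK.
Qed.

End modulus.

(** * Nonexistence of a larger domain space *)

Theorem theorem5p3 (R : realType) :
  ~ exists (Zs : set (R -> R[i])) (nZ : (R -> R[i]) -> R),
      [/\ banach_function_space Zs nZ,
          (* L^2 is contained in Z *)
          (forall f, inL2 f -> Zs f),
          (* strictly: some element of Z is not (a.e. equal to) an L^2 function *)
          (exists f, Zs f /\ ~ (exists g, inL2 g /\ ae11 (fun x => f x = g x))),
          (* Z is contained in L^1 *)
          (forall f, Zs f -> inL1 f) &
          (* T maps Z continuously into L^2 *)
          (exists c : R, forall f, Zs f ->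
             exists g, [/\ inL2 g, ae11 (fun x => hilbertT f x = g x) &
                           L2norm g <= c * nZ f])].
Proof.
move=> [Zs [nZ [[_ [_ [nZ0 _ _ _] _ ideal _]] _ [f [Zf fNL2]] ZL1 [c Tc]]]].
have [mf fL1] := ZL1 f Zf.
(* The element [f] of [Z] is its own representative; what remains is that it is square
   integrable. *)
apply: fNL2; exists f; split; last first.
  by apply: (aeW lebesgue_measure).
split => //.
have mI : measurable (@I11 R) by exact: measurable_itv.
pose h : R -> R := (fun x => cabs (f x)) \_ (@I11 R).
have mcf := measurable_cabs mf.
have mh : measurable_fun [set: R] h by apply/(measurable_restrictT _ mI).
have h0 x : 0 <= h x by rewrite /h patchE; case: ifP => // _; exact: cabs_ge0.
have inth : lebesgue_measure.-integrable [set: R] (EFin \o h).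
  rewrite /h -restrict_EFin; apply: (iffLR (integrable_mkcond _ _)) => //.
  apply/integrableP; split; first exact/measurable_EFinP.
  by under eq_integral => x _ do rewrite /= ger0_norm ?cabs_ge0//.
have hI x : ~ I11 x -> h x = 0.
  by move=> Ix; rewrite /h patchE memNset.
have hE x : I11 x -> h x = cabs (f x).
  by move=> Ix; rewrite /h patchE mem_set.
(* The sign of [c] is unknown, and [|c|] keeps the bound monotone in the norm. *)
have hM : hilbert_minorants_le h ((`|c| * nZ f) ^+ 2).
  move=> u um uh.
  pose v x : R[i] := (u x)%:C%C.
  have mv : cmeasurable v by split; [exact: measurable_funTS um|exact: measurable_cst].
  have [Zv vf] : Zs v /\ nZ v <= nZ f.
    apply: ideal => //; apply: (aeW lebesgue_measure) => x Ix.
    by rewrite cabs_real -hE.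
  have [g [gL2 Tg gn]] := Tc v Zv.
  exists (fun x => cre (g x)); split.
  - by case: gL2 => -[].
  (* Since [v] is real valued, the real part of its transform is [hilbert_real u]. *)
  - by apply: ae11S Tg => x _ <-; rewrite cre_hilbertT_real.
  - apply: integral_cre_sqr_le => //; apply: (le_trans gn).
    apply: (@le_trans _ _ (`|c| * nZ v)); last exact: ler_wpM2l.
    by apply: ler_wpM2r; [exact: nZ0|exact: ler_norm].
have := integral_sqr_le_of_hilbert_minorants mh h0 inth hI hM.
under eq_integral => x /set_mem Ix do rewrite hE//.
by move/le_lt_trans; apply; rewrite ltry.
Qed.
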